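(* Let $F_{(\alpha,q_n)}$ be a GNR-surface with Frenet frame $\{\vec q_n,\vec h,\vec a\}$ and let the angle function $\theta$ between $\vec q_n$ and $\vec N$ be given by $\theta=-\int\tau\,ds$ (i.e. $\theta'=-\tau$). Then $F_{(\alpha,q_n)}$ is an $h$-slant ruled surface if and only if $\alpha$ is a general helix.
   Context: Let $I\subset\mathbb{R}$ be an open interval and $\alpha:I\to\mathbb{R}^3$ a smooth unit speed curve with arclength parameter $s$, positively oriented orthonormal Frenet frame $\{\vec T,\vec N,\vec B\}$, curvature $\kappa$ and torsion $\tau$: $\vec T=\vec\alpha'$, $\vec T'=\kappa\vec N$, $\vec N'=-\kappa\vec T+\tau\vec B$, $\vec B'=-\tau\vec N$ (prime is $d/ds$). Let $\theta:I\to\mathbb{R}$ be smooth and $a_1=\cos\theta$, $a_2=\sin\theta$. The generalized normal ruled surface (GNR-surface) of $\alpha$ is $\vec F_{(\alpha,q_n)}(s,u)=\vec\alpha(s)+u\,\vec q_n(s)$, $(s,u)\in I\times\mathbb{R}$, with ruling $\vec q_n=\cos\theta\,\vec N+\sin\theta\,\vec B$. It is assumed that $\vec q_n'\neq0$ on $I$, so that the Frenet frame $\{\vec q_n,\vec h,\vec a\}$ of the ruled surface is defined by the central normal $\vec h=\vec q_n'/\lVert\vec q_n'\rVert$ and central tangent $\vec a=\vec q_n\times\vec h$. A ruled surface is called $h$-slant if its central normal $\vec h$ makes a constant angle with a fixed direction. A general helix is a curve whose unit tangent $\vec T$ makes a constant angle with a fixed direction. *)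

(* Defs.v *)
From HB Require Import structures.
From mathcomp Require Import all_boot all_order all_algebra.
From mathcomp Require Import all_classical all_reals all_analysis.

Set Implicit Arguments.
Unset Strict Implicit.
Unset Printing Implicit Defensive.

Import Order.TTheory GRing.Theory Num.Theory.
Import numFieldNormedType.Exports.

Local Open Scope classical_set_scope.
Local Open Scope ring_scope.

Definition dotmul (R : realType) (u v : 'rV[R]_3) : R := (u *m v^T) 0 0.

(* The norm [`|u|] of the library on ['rV[R]_3] is the sup norm, hence this
   separate Euclidean norm.  Both induce the same topology, so the library's
   derivatives of curves are the usual ones. *)
Definition enorm (R : realType) (u : 'rV[R]_3) : R := Num.sqrt (dotmul u u).

(* The indices in ['I_3] are added modulo 3. *)
Definition crossmul (R : realType) (u v : 'rV[R]_3) : 'rV[R]_3 :=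
  \row_(j < 3) (u 0 (j + 1) * v 0 (j + 2%:R) - u 0 (j + 2%:R) * v 0 (j + 1)).

Definition normalize (R : realType) (u : 'rV[R]_3) : 'rV[R]_3 :=
  (enorm u)^-1 *: u.

Definition angle (R : realType) (u v : 'rV[R]_3) : R :=
  acos (dotmul u v / (enorm u * enorm v)).

Definition open_interval (R : realType) (I : set R) : Prop :=
  [/\ open I, is_interval I & I !=set0].

(* Functions on [I] are represented by total functions on [R]; since [I] is
   open, derivatives at points of [I] depend only on the values on [I]. *)
Definition smooth_on (R : realType) (V : normedModType R) (I : set R)
    (f : R -> V) : Prop :=
  forall (n : nat) (s : R), I s -> derivable (derive1n n f) s 1.

(* The last condition on the triple fixes the orientation. *)
Definition positive_orthonormal (R : realType) (T N B : 'rV[R]_3) : Prop :=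
  [/\ dotmul T T = 1, dotmul N N = 1 & dotmul B B = 1] /\
  [/\ dotmul T N = 0, dotmul T B = 0, dotmul N B = 0 & B = crossmul T N].

(* As [N] is a unit vector, [curvature_ge0] and [deriv_tangent] say that
   [kappa] is the Euclidean norm of the derivative of [T]. *)
Record frenet_frame (R : realType) (I : set R) (alpha T N B : R -> 'rV[R]_3)
    (kappa tau : R -> R) : Prop := FrenetFrame {
  frame_orthonormal : forall s, I s -> positive_orthonormal (T s) (N s) (B s);
  curvature_ge0 : forall s, I s -> 0 <= kappa s;
  deriv_curve : forall s, I s -> is_derive s 1 alpha (T s);
  deriv_tangent : forall s, I s -> is_derive s 1 T (kappa s *: N s);
  deriv_normal : forall s, I s ->
    is_derive s 1 N (- kappa s *: T s + tau s *: B s);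
  deriv_binormal : forall s, I s -> is_derive s 1 B (- tau s *: N s)
}.

Definition unit_speed (R : realType) (I : set R) (alpha : R -> 'rV[R]_3) :
    Prop :=
  forall s, I s -> enorm (derive1 alpha s) = 1.

Record ruled_surface (R : realType) := RuledSurface {
  base_curve : R -> 'rV[R]_3;
  ruling : R -> 'rV[R]_3
}.

Definition ruled_map (R : realType) (F : ruled_surface R) (s u : R) :
    'rV[R]_3 :=
  base_curve F s + u *: ruling F s.

Definition central_normal (R : realType) (F : ruled_surface R) (s : R) :
    'rV[R]_3 :=
  normalize (derive1 (ruling F) s).

Definition central_tangent (R : realType) (F : ruled_surface R) (s : R) :
    'rV[R]_3 :=
  crossmul (ruling F s) (central_normal F s).

Definition gnr_surface (R : realType) (alpha N B : R -> 'rV[R]_3)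
    (theta : R -> R) : ruled_surface R :=
  RuledSurface alpha (fun s => cos (theta s) *: N s + sin (theta s) *: B s).

Definition constant_angle (R : realType) (I : set R) (X : R -> 'rV[R]_3) :
    Prop :=
  exists d : 'rV[R]_3, d != 0 /\
    exists phi : R, forall s, I s -> angle (X s) d = phi.

Definition h_slant (R : realType) (I : set R) (F : ruled_surface R) : Prop :=
  constant_angle I (central_normal F).

Definition general_helix (R : realType) (I : set R) (alpha : R -> 'rV[R]_3) :
    Prop :=
  constant_angle I (fun s => normalize (derive1 alpha s)).

(* Main.v *)
Require Import Defs.
From HB Require Import structures.
From mathcomp Require Import all_boot all_order all_algebra.
From mathcomp Require Import all_classical all_reals all_analysis.
From mathcomp Require Import ring.

(** The derivative of the ruling cos theta N + sin theta B has the
    component - kappa cos theta along T, while its components along N and B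
    are multiples of theta' + tau.  When theta' = - tau only the tangential
    part survives ([is_derive_ruling]), so the central normal is the unit
    tangent up to the sign of - kappa cos theta.  That derivative does not
    vanish, so kappa > 0 and cos theta is nowhere zero; since cos theta is
    continuous on an interval, it keeps a constant sign there ([sgr_constant]).
    Hence h = eps T with the same eps = 1 or eps = -1 at every point, and
    T makes a constant angle with a direction d exactly when eps T makes
    the same angle with eps d ([constant_angle_scale]).  The constancy of
    the sign matters: the angle with d and the angle with - d are
    supplementary, so a sign jump would break the equivalence. *)

Set Implicit Arguments.
Unset Strict Implicit.
Unset Printing Implicit Defensive.

Import Order.TTheory GRing.Theory Num.Theory.
Import numFieldNormedType.Exports.

Local Open Scope classical_set_scope.
Local Open Scope ring_scope.

Section EuclideanGeometry.
Variable R : realType.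
Implicit Types (u v : 'rV[R]_3) (X Y : R -> 'rV[R]_3).

Lemma dotmulZ (c e : R) u v : dotmul (c *: u) (e *: v) = c * e * dotmul u v.
Proof.
by rewrite /dotmul -scalemxAl linearZ /= -scalemxAr scalerA mxE.
Qed.

Lemma enormZ (c : R) u : enorm (c *: u) = `|c| * enorm u.
Proof. by rewrite /enorm dotmulZ -expr2 sqrtrM ?sqr_ge0// sqrtr_sqr. Qed.

Lemma normalizeZ (c : R) u : enorm u = 1 -> normalize (c *: u) = Num.sg c *: u.
Proof.
move=> u1; rewrite /normalize enormZ u1 mulr1 scalerA; congr (_ *: _).
have [->|c0] := eqVneq c 0; first by rewrite mulr0 sgr0.
by rewrite {2}[c]numEsg mulrC mulfK// normr_eq0.
Qed.

Lemma angleZ (c : R) u v : c != 0 -> angle (c *: u) (c *: v) = angle u v.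
Proof.
move=> c0; rewrite /angle dotmulZ !enormZ mulrACA -normrM -expr2.
by rewrite ger0_norm ?sqr_ge0// -mulf_div divff ?mul1r// expf_neq0.
Qed.

(** A common factor is absorbed by the direction, the angle with d becoming
    the angle with c d; this works for negative factors too. *)
Lemma constant_angle_scale (I : set R) (c : R) X Y : c != 0 ->
  (forall s, I s -> X s = c *: Y s) -> constant_angle I X <-> constant_angle I Y.
Proof.
move=> c0 XY; split=> -[d [d0 [phi dphi]]].
- exists (c^-1 *: d); split; first by rewrite scaler_eq0 invr_eq0 (negPf c0).
  exists phi => s Is; rewrite -(dphi s Is) XY//.
  by rewrite -(angleZ (Y s) _ c0) scalerA divff// scale1r.
- exists (c *: d); split; first by rewrite scaler_eq0 (negPf c0).
  by exists phi => s Is; rewrite -(dphi s Is) XY// angleZ.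
Qed.

End EuclideanGeometry.

(** In each coordinate this is the product rule for real functions. *)
Lemma is_derive_scale (R : realType) (f : R -> R) (X : R -> 'rV[R]_3)
    (s f' : R) (X' : 'rV[R]_3) :
  is_derive s 1 f f' -> is_derive s 1 X X' ->
  is_derive s 1 (fun t => f t *: X t) (f s *: X' + f' *: X s).
Proof.
move=> df dX.
have dXij i j : is_derive s 1 (fun t => X t i j) (X' i j).
  have [dX1 <-] := dX; rewrite derive_mx// mxE.
  by apply: DeriveDef => //; exact: (derivable_mxP _ _ _).1.
have dfX i j : is_derive s 1 (fun t => (f t *: X t) i j)
    ((f s *: X' + f' *: X s) i j).
  have -> : (fun t => (f t *: X t) i j) = (f * (fun t => X t i j)).
    by apply/funext => t; rewrite mxE.
  apply: is_derive_eq (is_deriveM df (dXij i j)) _.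
  by rewrite !mxE [f' * _]mulrC.
have dfX1 : derivable (fun t => f t *: X t) s 1.
  by apply/derivable_mxP => i j; case: (dfX i j).
apply: DeriveDef => //; rewrite derive_mx//.
by apply/matrixP => i j; rewrite mxE; case: (dfX i j).
Qed.

(** By the intermediate value theorem a change of sign forces a zero. *)
Lemma sgr_constant (R : realType) (I : set R) (f : R -> R) :
  is_interval I -> (forall s, I s -> {for s, continuous f}) ->
  (forall s, I s -> f s != 0) ->
  forall s t, I s -> I t -> Num.sg (f s) = Num.sg (f t).
Proof.
move=> itvI cf f0.
move=> s t; wlog st : s t / s <= t => [H Is It|Is It].
  by case: (leP s t) => [|/ltW] /H ->.
have stI x : s <= x <= t -> I x by exact: itvI.
have cst : {within `[s, t], continuous f}.
  apply: continuous_in_subspaceT => x; rewrite inE /= in_itv /= => /stI.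
  exact: cf.
have [fst|fst] := boolP (Num.min (f s) (f t) <= 0 <= Num.max (f s) (f t)).
  have [c /[!in_itv]/= /stI/f0/eqP c0 fc0] := IVT st cst fst.
  by case: c0.
move: fst (f0 _ Is) (f0 _ It).
case: (sgrP (f s)) => // fs; case: (sgrP (f t)) => // ft.
- by rewrite ge_min le_max (ltW fs) (ltW ft) orbT.
- by rewrite ge_min le_max (ltW fs) (ltW ft) orbT.
Qed.

(** The normal and binormal components are multiples of theta' + tau, and
    this sum is 0. *)
Lemma is_derive_ruling (R : realType) (I : set R)
    (alpha T N B : R -> 'rV[R]_3) (kappa tau theta : R -> R) (s : R) :
  frenet_frame I alpha T N B kappa tau -> I s ->
  is_derive s 1 theta (- tau s) ->
  is_derive s 1 (ruling (gnr_surface alpha N B theta))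
    (- (kappa s * cos (theta s)) *: T s).
Proof.
move=> F Is dth.
have dcos : is_derive s 1 (cos \o theta) (- sin (theta s) * - tau s).
  exact: is_derive1_comp.
have dsin : is_derive s 1 (sin \o theta) (cos (theta s) * - tau s).
  exact: is_derive1_comp.
have dN := is_derive_scale dcos (deriv_normal F Is).
have dB := is_derive_scale dsin (deriv_binormal F Is).
apply: is_derive_eq (is_deriveD dN dB) _.
apply/rowP => j; rewrite !mxE /=; ring.
Qed.

Theorem corollary3p22 (R : realType) (I : set R)
    (alpha T N B : R -> 'rV[R]_3) (kappa tau theta : R -> R)
    (I_open_interval : open_interval I)
    (alpha_smooth : smooth_on I alpha)
    (alpha_unit_speed : unit_speed I alpha)
    (alpha_frenet : frenet_frame I alpha T N B kappa tau)
    (theta_smooth : smooth_on I theta)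
    (ruling_deriv_neq0 : forall s, I s ->
       derive1 (ruling (gnr_surface alpha N B theta)) s != 0)
    (theta_deriv : forall s, I s -> derive1 theta s = - tau s) :
  h_slant I (gnr_surface alpha N B theta) <-> general_helix I alpha.
Proof.
have [_ itvI [s0 Is0]] := I_open_interval.
have dth s : I s -> is_derive s 1 theta (- tau s).
  move=> Is; have dths := theta_smooth 0%N s Is.
  by apply: DeriveDef => //; rewrite -derive1E theta_deriv.
have dq s (Is : I s) : derive1 (ruling (gnr_surface alpha N B theta)) s
    = - (kappa s * cos (theta s)) *: T s.
  by rewrite derive1E; case: (is_derive_ruling alpha_frenet Is (dth s Is)).
have dalpha s (Is : I s) : derive1 alpha s = T s.
  by rewrite derive1E; case: (deriv_curve alpha_frenet Is).
have T1 s (Is : I s) : enorm (T s) = 1 by rewrite -dalpha// alpha_unit_speed.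
have kcos0 s (Is : I s) : kappa s * cos (theta s) != 0.
  apply: contra_neq (ruling_deriv_neq0 s Is) => kc0.
  by rewrite dq// kc0 oppr0 scale0r.
have cos0 s (Is : I s) : cos (theta s) != 0.
  by have := kcos0 s Is; rewrite mulf_eq0 negb_or => /andP[].
have kappa_gt0 s (Is : I s) : 0 < kappa s.
  rewrite lt_def (curvature_ge0 alpha_frenet Is) andbT.
  by have := kcos0 s Is; rewrite mulf_eq0 negb_or => /andP[].
have ccos s : I s -> {for s, continuous (cos \o theta)}.
  move=> Is; apply: continuous_comp; last exact: continuous_cos.
  by apply/differentiable_continuous/derivable1_diffP; case: (dth s Is).
have sgcos := sgr_constant itvI ccos cos0.
apply: (@constant_angle_scale _ _ (- Num.sg (cos (theta s0)))).
  by rewrite oppr_eq0 sgr_eq0 cos0.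
move=> s Is; rewrite /central_normal dq// normalizeZ ?T1//.
rewrite dalpha// /normalize T1// invr1 scale1r.
by rewrite sgrN sgrM (gtr0_sg (kappa_gt0 s Is)) mul1r -(sgcos s0 s).
Qed.
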